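(* Let $t$ be arbitrary (including $t=0$). For $n\ge 0$ let $H_n$ be the $n\times n$ Hankel matrix with entries $(H_n)_{i,j}=f(i+j-2,t,1)$ for $1\le i,j\le n$, where $f(m,t,1)$ is the total weight of the lattice paths from $(0,0)$ to $(m,0)$ that never run below the $x$-axis and use the steps $U=(1,1)$, $H=(1,0)$, $D=(1,-1)$, each $H$ step having weight $t$ and each $U$ and $D$ step having weight $1$. Then for all $n\ge 0$, $$\det(H_n)=1.$$
   Context: The weight of a path is the product of the weights of its steps; the weight of a set of paths is the sum of the weights of its paths. The path of length zero has weight $1$, so $f(0,t,1)=1$. The weight $t$ may be taken to be an arbitrary number or an indeterminate. Equivalently, $F(x)=\sum_{m\ge0}f(m,t,1)x^m$ satisfies $F(x)=1+txF(x)+x^2F(x)^2$. The determinant of the $0\times 0$ matrix is $1$. *)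

(* Defs.v *)
From HB Require Import structures.
From mathcomp Require Import all_boot all_order all_algebra.

Set Implicit Arguments.
Unset Strict Implicit.
Unset Printing Implicit Defensive.

Import Order.TTheory GRing.Theory Num.Theory.
Local Open Scope ring_scope.

Inductive step := U | H | D.

Definition step_code (s : step) : option bool :=
  match s with U => Some true | H => None | D => Some false end.
Definition step_decode (c : option bool) : step :=
  match c with Some true => U | None => H | Some false => D end.
Lemma step_codeK : cancel step_code step_decode.
Proof. by case. Qed.

HB.instance Definition _ := Finite.copy step (can_type step_codeK).

Definition step_vec (s : step) : int * int :=
  match s with U => (1, 1) | H => (1, 0) | D => (1, -1) end.

Definition endpoint (p : seq step) : int * int := \sum_(s <- p) step_vec s.

(* All lattice points visited after each step. As the endpoints of a straight
   step bound its height, the path stays weakly above the x-axis iff these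
   points do. *)
Definition visited (p : seq step) : seq (int * int) :=
  scanl +%R (0, 0) (map step_vec p).

Definition nonneg_path (p : seq step) : bool :=
  all (fun P : int * int => 0 <= P.2) (visited p).

Definition path_to (m : nat) (p : seq step) : bool :=
  (endpoint p == (m%:Z, 0)) && nonneg_path p.

(* Every step advances the abscissa by 1, so a path ending at (m, 0) has
   exactly m steps: the sum over m.-tuple step in f below omits no path. *)
Lemma size_path_to (m : nat) (p : seq step) : path_to m p -> size p = m.
Proof.
suff e1 : (endpoint p).1 = (size p)%:Z.
  by case/andP=> /eqP e _; move: e1; rewrite e => -[].
rewrite /endpoint; elim: p => [|s p IHp]; first by rewrite big_nil.
by rewrite big_cons /= IHp -add1n PoszD; case: s.
Qed.

Definition step_weight (R : comNzRingType) (t : R) (s : step) : R :=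
  match s with U => 1 | H => t | D => 1 end.

Definition path_weight (R : comNzRingType) (t : R) (p : seq step) : R :=
  \prod_(s <- p) step_weight t s.

(* f(m, t, 1): the last argument 1 is the length of the horizontal step. *)
Definition f (R : comNzRingType) (m : nat) (t : R) : R :=
  \sum_(p : m.-tuple step | path_to m p) path_weight t p.

(* Indices in 'I_n start at 0, so the index i + j - 2 becomes i + j. *)
Definition hankel (R : comNzRingType) (t : R) (n : nat) : 'M[R]_n :=
  \matrix_(i < n, j < n) f (i + j)%N t.

(* Main.v *)
Require Import Defs.
From mathcomp Require Import all_boot all_order all_algebra.
From mathcomp Require Import zify ring.
Import GRing.Theory.
Local Open Scope ring_scope.

(** Let J be the tridiagonal operator with [t] on the diagonal and [1] just
    above and just below it, acting on functions of a height, and let [e] be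
    the indicator of height 0.  Splitting off the first step shows that the
    paths of length [m] from height [h] to height 0 which stay weakly above
    the axis have total weight [(J^m e) h]; so [f m t = (J^m e) 0] is the
    scalar product <J^m e, e>.

    Since J is symmetric, <J^(i+j) e, e> = <J^i e, J^j e>.  The Hankel matrix
    is therefore [L *m L^T], where row [i] of [L] is [J^i e].  As J raises the
    height by at most one, with coefficient 1, [L] is lower triangular with
    ones on the diagonal, and the determinant is 1.

    The two halves are [f_descent], which links [f] to the powers of J, and
    [hankel_factor], which comes from the symmetry of J ([jacobi_sym]). *)

Section Descents.

Variables (R : comNzRingType) (t : R).
Implicit Types (a b : nat -> R) (m n h i j k N : nat) (p : seq step).

Definition jacobi a k : R :=
  (if k is k'.+1 then a k' else 0) + t * a k + a k.+1.

Definition descent m : nat -> R := iter m jacobi (fun k => (k == 0%N)%:R).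

Lemma descentS m k : descent m.+1 k = jacobi (descent m) k.
Proof. by []. Qed.

(** The height is kept as a natural number so that nonnegativity is built into
    the recursion, which then mirrors the clauses of [jacobi]. *)
Fixpoint descends h p : bool :=
  if p is s :: p' then
    match s with
    | U => descends h.+1 p'
    | H => descends h p'
    | D => if h is h'.+1 then descends h' p' else false
    end
  else h == 0%N.

(** The starting abscissa and height have to be general for the induction: the
    tail of a path starts elsewhere than at the origin. *)
Lemma descendsE p (x : int) h :
  (h%:Z + (endpoint p).2 == 0)
    && all (fun P : int * int => 0 <= P.2)
           (scanl +%R (x, h%:Z) (map step_vec p))
  = descends h p.
Proof.
elim: p x h => [|s p IHp] x h; first by rewrite /endpoint big_nil /= addr0 andbT.
have -> : (endpoint (s :: p)).2 = (step_vec s).2 + (endpoint p).2.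
  by rewrite /endpoint big_cons.
have move_step (v : int * int) h' : h%:Z + v.2 = h'%:Z ->
    (x, h%:Z) + v = (x + v.1, h'%:Z).
  by move=> <-; case: v.
rewrite addrA map_cons [scanl _ _ _]/= [all _ _]/=.
case: s => /=.
- have up : h%:Z + 1 = h.+1%:Z by lia.
  by rewrite (move_step (1, 1) _ up) up /= IHp.
- by rewrite (move_step (1, 0) h (addr0 _)) addr0 /= IHp.
case: h move_step => [|h] move_step; first by rewrite andbF.
have down : h.+1%:Z + -1 = h%:Z by lia.
by rewrite (move_step (1, -1) _ down) down /= IHp.
Qed.

Lemma path_to_descends m (p : m.-tuple step) : path_to m p = descends 0 p.
Proof.
rewrite -(descendsE p 0 0) /path_to /nonneg_path /visited add0r.
have -> // : (endpoint p == (m%:Z, 0)) = ((endpoint p).2 == 0).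
have abscissa q : (endpoint q).1 = (size q)%:Z.
  rewrite /endpoint; elim: q => [|s q IHq]; first by rewrite big_nil.
  by rewrite big_cons /= IHq -add1n PoszD; case: s.
by rewrite -[LHS]/(_ && _) abscissa size_tuple eqxx.
Qed.

Lemma sum_step (F : step -> R) : \sum_s F s = F U + F H + F D.
Proof.
rewrite (bigD1 U) // (bigD1 H) // (bigD1 D) //= big1 ?addr0 ?addrA //.
by case.
Qed.

Lemma sum_tuple_cons (T : finType) m (F : seq T -> R) :
  \sum_(p : m.+1.-tuple T) F p = \sum_x \sum_(p : m.-tuple T) F (x :: p).
Proof.
rewrite pair_bigA /=.
rewrite (reindex (fun u : T * m.-tuple T => [tuple of u.1 :: u.2])) //=.
exists (fun p : m.+1.-tuple T => (thead p, [tuple of behead p])) => [[x p]|p] _.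
  by congr pair; apply/val_inj.
by rewrite /= -tuple_eta.
Qed.

Lemma sum_descends m h :
  \sum_(p : m.-tuple step | descends h p) path_weight t p = descent m h.
Proof.
have weightS s p : path_weight t (s :: p) = step_weight t s * path_weight t p.
  by rewrite /path_weight big_cons.
elim: m h => [|m IHm] h; rewrite big_mkcond.
  rewrite (eq_bigr (fun=> (h == 0%N)%:R)) => [|p _]; last first.
    by rewrite [p]tuple0 /= /path_weight big_nil; case: eqP.
  by rewrite sumr_const card_tuple expn0.
rewrite (sum_tuple_cons _ m
  (fun q => if descends h q then path_weight t q else 0)) sum_step.
have first_step s h' : (forall p, descends h (s :: p) = descends h' p) ->
    \sum_(p : m.-tuple step)
      (if descends h (s :: p) then path_weight t (s :: p) else 0)
    = step_weight t s * descent m h'.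
  move=> descs; rewrite -IHm mulr_sumr [RHS]big_mkcond.
  by apply: eq_bigr => p _; rewrite descs weightS.
rewrite descentS /jacobi (first_step U h.+1) // (first_step H h) // mul1r.
case: h first_step => [|h] first_step.
  by rewrite /= big1 // add0r addr0 addrC.
by rewrite (first_step D h) //= mul1r; ring.
Qed.

Lemma f_descent m : f m t = descent m 0.
Proof.
by rewrite -sum_descends /f; apply: eq_bigl => p; rewrite path_to_descends.
Qed.

Lemma descent_gt m k : (m < k)%N -> descent m k = 0.
Proof.
elim: m k => [|m IHm] [|k] // lt_mk.
by rewrite descentS /jacobi !IHm ?mulr0 ?addr0 //; lia.
Qed.

Lemma descent_diag m : descent m m = 1.
Proof.
elim: m => [|m IHm] //.
by rewrite descentS /jacobi IHm !descent_gt ?mulr0 ?addr0.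
Qed.

(** Truncating the scalar products at height [N] breaks the symmetry of the
    operator only by the edge between the heights [N] and [N.+1]. *)
Lemma jacobi_green a b N :
  \sum_(k < N.+1) jacobi a k * b k + a N * b N.+1
  = \sum_(k < N.+1) a k * jacobi b k + a N.+1 * b N.
Proof.
elim: N => [|N IHN]; first by rewrite !big_ord1 /jacobi /=; ring.
rewrite big_ord_recr [in RHS]big_ord_recr /=.
have -> : \sum_(k < N.+1) jacobi a k * b k
  = \sum_(k < N.+1) a k * jacobi b k + a N.+1 * b N - a N * b N.+1.
  by rewrite -IHN addrK.
by rewrite /jacobi /=; ring.
Qed.

Lemma jacobi_sym a b N : a N.+1 = 0 -> b N.+1 = 0 ->
  \sum_(k < N.+1) jacobi a k * b k = \sum_(k < N.+1) a k * jacobi b k.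
Proof.
by move=> a0 b0; have := jacobi_green a b N; rewrite a0 b0 mulr0 mul0r !addr0.
Qed.

(** Symmetry moves one J at a time from the right factor to the left; the
    bound on [N] keeps both factors zero above the truncation throughout. *)
Lemma sum_descentM_wide i j N : (i + j <= N)%N ->
  \sum_(k < N.+1) descent i k * descent j k = descent (i + j) 0.
Proof.
elim: j i => [|j IHj] i le_N.
  rewrite big_ord_recl big1 => [|k _]; last by rewrite mulr0.
  by rewrite mulr1 addr0 addn0.
rewrite -addSnnS -IHj; last by lia.
by rewrite -jacobi_sym //; apply: descent_gt; lia.
Qed.

Lemma sum_descentM i j n : (i < n)%N ->
  \sum_(k < n) descent i k * descent j k = descent (i + j) 0.
Proof.
move=> lt_in.
(* The terms of height above [i] vanish, so [n] may be enlarged to a bound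
   above [i + j], high enough for the truncated symmetry. *)
rewrite -(@sum_descentM_wide i j (n + j)) ?leq_add2r 1?ltnW //.
rewrite -addnS big_split_ord /= [X in _ = _ + X]big1 ?addr0 // => k _.
by rewrite descent_gt ?mul0r //=; lia.
Qed.

Definition descent_mx n : 'M[R]_n := \matrix_(i, k) descent i k.

Lemma det_descent_mx n : \det (descent_mx n) = 1.
Proof.
rewrite det_trig; last by apply/is_trig_mxP => i k ?; rewrite mxE descent_gt.
by rewrite big1 // => i _; rewrite mxE descent_diag.
Qed.

Lemma hankel_factor n : hankel t n = descent_mx n *m (descent_mx n)^T.
Proof.
apply/matrixP => i j; rewrite !mxE f_descent -(@sum_descentM i j n) //.
by apply: eq_bigr => k _; rewrite !mxE.
Qed.

End Descents.

Theorem proposition1p1 (R : comNzRingType) (t : R) (n : nat) :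
  \det (hankel t n) = 1.
Proof. by rewrite hankel_factor det_mulmx det_tr det_descent_mx mulr1. Qed.
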